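(* There is a map $F$ from the power set $\mathcal{P}(\omega)$ to the collection of $D_2(\mathbf{\Sigma}^0_1)$-subsets of $\mathbb{R}$ such that for all $a,b\subseteq\omega$, $$a\subseteq_{\mathsf{fin}} b\iff F(a)\leq F(b).$$ That is, the quasi-order $\mathcal{P}(\omega)/\mathsf{fin}$ is reducible to the Wadge quasi-order for the real line restricted to its $D_2(\mathbf{\Sigma}^0_1)$-subsets.
   Context: For subsets $A,B$ of $\mathbb{R}$, $A\leq B$ ($A$ is reducible to $B$) means that there is a continuous function $f\colon\mathbb{R}\to\mathbb{R}$ with $A=f^{-1}(B)$; this is the Wadge quasi-order for the real line. A subset of $\mathbb{R}$ is $D_2(\mathbf{\Sigma}^0_1)$ if it is the intersection of an open and a closed set. $\mathcal{P}(\omega)/\mathsf{fin}$ is here regarded as the quasi-order on $\mathcal{P}(\omega)$ given by inclusion up to finite error: $a\subseteq_{\mathsf{fin}}b$ iff $a\setminus b$ is finite. A quasi-order is a reflexive transitive relation; a reduction between quasi-orders is a function $F$ such that $x\leq y$ if and only if $F(x)\leq F(y)$ for all $x,y$, and a quasi-order is reducible to another if there is a reduction from the former to the latter. *)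

(* Defs.v *)
From mathcomp Require Import all_boot all_order all_algebra.
From mathcomp Require Import all_classical all_reals all_analysis.
Import numFieldNormedType.Exports.

Set Implicit Arguments.
Unset Strict Implicit.
Unset Printing Implicit Defensive.

Local Open Scope classical_set_scope.

Definition subset_fin (a b : set nat) : Prop := finite_set (a `\` b).

Definition wadge_le (R : realType) (A B : set R) : Prop :=
  exists f : R -> R, continuous f /\ A = f @^-1` B.

Definition D2_Sigma01 (R : realType) (A : set R) : Prop :=
  exists U C : set R, [/\ open U, closed C & A = U `&` C].

(* Main.v *)
(** Let [P] be the union of the half-open arcs [[2 n pi, (2 n + 1) pi[].  If two
continuous maps [u], [v] have the same preimage of [P], then [u - v] never equals
an odd multiple of [pi], so by connectedness [u - v] is bounded: sets pulled back
from [P] remember real functions up to a bounded error.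

Let [h] be the zigzag with [h n = (-2)^n], affine between integers, and let
[F a] be the preimage of [P] under [h \o w_a], where [w_a] is the identity on
[[k, k + 1]] if [k] is even or [k./2 \in a], and an N-shaped path from [k] to
[k + 1] otherwise.

If [a `\` b] is finite, choose an even [k] beyond which the bits of [a] are below
those of [b].  Everything left of [k + 1] folds onto the single affine run of [h]
over [[k, k + 1]], whose range contains all earlier values of [h].  Further
right, the N-shapes of [a] outside [b] can be traced along the straight runs of [b].

Conversely, if [h \o w_b \o f] is within [C] of [h \o w_a], the exponential
growth of [h] forces [f k] to be near [k] for all large [k]; a straight run of
[a] cannot then be carried along an N-shape of [b]. *)

Require Import Defs.
From mathcomp Require Import all_boot all_order all_algebra.
From mathcomp Require Import all_classical all_reals all_analysis.
From mathcomp Require Import ring lra.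
Import Order.TTheory GRing.Theory Num.Theory numFieldNormedType.Exports.

Set Implicit Arguments.
Unset Strict Implicit.
Unset Printing Implicit Defensive.

Local Open Scope classical_set_scope.
Local Open Scope ring_scope.

(** * Intermediate values and composition *)

Lemma IVT_le (R : realType) (f : R -> R) (a b v : R) :
  continuous f -> a <= b -> f a <= v <= f b ->
  exists c, [/\ a <= c, c <= b & f c = v].
Proof.
move=> cf ab /andP[fav vfb].
have [|c] := IVT (v := v) ab (continuous_subspaceT cf).
  by rewrite ge_min fav/= le_max vfb orbT.
by rewrite in_itv/= => /andP[ac cb] fc; exists c.
Qed.

Lemma comp_continuous (R : realType) (f g : R -> R) :
  continuous f -> continuous g -> continuous (g \o f).
Proof. by move=> cf cg x; apply: continuous_comp; [exact: cf | exact: cg]. Qed.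

(** * Gluing paths along unit intervals *)

Definition glue (R : realType) (phi : nat -> R -> R) (x : R) : R :=
  \sum_(k < (Num.truncn x).+1) phi k (x - k%:R).

Section Glue.
Context {R : realType}.
Variables (phi : nat -> R -> R) (w : nat -> R).
Hypothesis phi_cont : forall k, continuous (phi k).
Hypothesis phi0 : forall k t, t <= 0 -> phi k t = 0.
Hypothesis phi1 : forall k t, 1 <= t -> phi k t = w k.

Lemma glueE (n : nat) (x : R) :
  x <= n%:R -> glue phi x = \sum_(k < n) phi k (x - k%:R).
Proof.
have stable m p : x <= m%:R ->
    \sum_(k < m + p) phi k (x - k%:R) = \sum_(k < m) phi k (x - k%:R).
  move=> xm; elim: p => [|p IH]; first by rewrite addn0.
  rewrite addnS big_ord_recr/= IH phi0 ?addr0// subr_le0.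
  by rewrite (le_trans xm)// ler_nat leq_addr.
move=> xn; rewrite /glue; set m := _.+1.
have xm : x <= m%:R by rewrite ltW// truncnS_gt.
by rewrite -(stable m n)// addnC stable.
Qed.

Lemma glue_continuous : continuous (glue phi).
Proof.
move=> x; set n := (Num.truncn x).+1.
have xn : x < n%:R by rewrite truncnS_gt.
have cs m : {for x, continuous (fun y : R => \sum_(k < m) phi k (y - k%:R))}.
  elim: m => [|m IH].
    rewrite (_ : (fun y : R => _) = cst 0); first exact: cst_continuous.
    by apply/funext => y; rewrite big_ord0.
  rewrite (_ : (fun y : R => _) = (fun y =>
      \sum_(k < m) phi k (y - k%:R)) + (fun y : R => phi m (y - m%:R))); last first.
    by apply/funext => y; rewrite big_ord_recr.
  apply: continuousD => //.
  apply: (continuous_comp (f := fun y : R => y - m%:R)); last exact: phi_cont.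
  by apply: continuousB; [exact: cvg_id | exact: cst_continuous].
(* The number of terms in [glue] jumps at integers; the fixed count [n > x] serves a whole
   neighbourhood of [x]. *)
rewrite /continuous_at (@glueE n x (ltW xn)).
apply: cvg_trans (cs n); apply: near_eq_cvg.
near=> y; rewrite (@glueE n)//; apply: ltW.
by near: y; exact: lt_nbhsl.
Unshelve. all: by end_near. Qed.

Lemma glue_le0 (x : R) : x <= 0 -> glue phi x = 0.
Proof. by move=> x0; rewrite (@glueE 0)// big_ord0. Qed.

Lemma glue_block (n : nat) (x : R) : n%:R <= x <= n.+1%:R ->
  glue phi x = \sum_(k < n) w k + phi n (x - n%:R).
Proof.
move=> /andP[nx xn]; rewrite (glueE xn) big_ord_recr/=; congr (_ + _).
apply: eq_bigr => k _; apply: phi1; rewrite lerBrDr nat1r.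
by rewrite (le_trans _ nx)// ler_nat.
Qed.

End Glue.

(** * Straight and N-shaped paths on one block *)

Definition clamp (R : realType) (t : R) : R := Num.max 0 (Num.min t 1).

(** On [[0, 1]] this is the N through (0, 0), (1/3, 2/3), (2/3, 1/3), (1, 1). *)
Definition zig (R : realType) (t : R) : R :=
  let c := clamp t in Num.max (Num.min (2 * c) (1 - c)) (2 * c - 1).

Section Shapes.
Context {R : realType}.
Implicit Types t : R.

Lemma clamp_le0 t : t <= 0 -> clamp t = 0.
Proof. by rewrite /clamp; case: (leP t 1) => ? ?; case: leP => ?; lra. Qed.

Lemma clamp_ge1 t : 1 <= t -> clamp t = 1.
Proof. by rewrite /clamp; case: (leP t 1) => ? ?; case: leP => ?; lra. Qed.

Lemma clamp_id t : 0 <= t <= 1 -> clamp t = t.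
Proof. by rewrite /clamp; case: (leP t 1) => ? ?; case: leP => ?; lra. Qed.

Lemma clamp_continuous : continuous (@clamp R).
Proof.
move=> t; apply: (@continuous_max _ _ (cst 0) (fun t => Num.min t 1)).
  exact: cst_continuous.
by apply: (@continuous_min _ _ id (cst 1)); [exact: cvg_id | exact: cst_continuous].
Qed.

Lemma zig_continuous : continuous (@zig R).
Proof.
have c2 t : {for t, continuous (fun t : R => 2 * clamp t)}.
  by apply: continuousM; [exact: cst_continuous | exact: clamp_continuous].
move=> t; apply: (@continuous_max _ _
  (fun t => Num.min (2 * clamp t) (1 - clamp t)) (fun t => 2 * clamp t - 1)).
  apply: (@continuous_min _ _ (fun t => 2 * clamp t) (fun t => 1 - clamp t)).
    exact: c2.
- by apply: continuousB; [exact: cst_continuous | exact: clamp_continuous].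
- by apply: continuousB; [exact: c2 | exact: cst_continuous].
Qed.

Lemma zig_le0 t : t <= 0 -> zig t = 0.
Proof.
move=> /clamp_le0; rewrite /zig => ->.
by case: (leP (2 * 0) (1 - 0)) => ?; case: leP => ?; lra.
Qed.

Lemma zig_ge1 t : 1 <= t -> zig t = 1.
Proof.
move=> /clamp_ge1; rewrite /zig => ->.
by case: (leP (2 * 1) (1 - 1)) => ?; case: leP => ?; lra.
Qed.

Lemma zigE t : 0 <= t <= 1 ->
  zig t = Num.max (Num.min (2 * t) (1 - t)) (2 * t - 1).
Proof. by move=> /clamp_id; rewrite /zig => ->. Qed.

End Shapes.

(** * The zigzag and the warps *)

Definition seg (R : realType) (b : bool) : R -> R :=
  if b then @clamp R else @zig R.

(* [zigzag n = (-2) ^+ n], affine on each [[n, n + 1]] and equal to 1 on the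
negative half-line. *)
Definition zigzag (R : realType) (x : R) : R :=
  1 + glue (fun k t => -3 * (-2) ^+ k * clamp t) x.

Definition warp (R : realType) (A : pred nat) (x : R) : R :=
  glue (fun k t => seg (A k) t) x.

Section ZigzagWarp.
Context {R : realType}.
Implicit Types (x t : R) (A B : pred nat).

Lemma seg_continuous b : continuous (@seg R b).
Proof. by case: b; [exact: clamp_continuous | exact: zig_continuous]. Qed.

Lemma seg_le0 b t : t <= 0 -> seg b t = 0.
Proof. by case: b; [exact: clamp_le0 | exact: zig_le0]. Qed.

Lemma seg_ge1 b t : 1 <= t -> seg b t = 1.
Proof. by case: b; [exact: clamp_ge1 | exact: zig_ge1]. Qed.

(** The last two clauses confine values below 1/3 to the first third of the block and values above
    2/3 to the last third, even on an N. *)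
Lemma seg_bounds b t : 0 <= t <= 1 ->
  [/\ 0 <= seg b t, seg b t <= 1, 1/3 <= t -> 1/3 <= seg b t
    & t <= 2/3 -> seg b t <= 2/3].
Proof.
move=> /andP[t0 t1]; case: b => /=.
  by rewrite clamp_id ?t0//; split.
rewrite zigE ?t0//; case: (leP (2 * t) (1 - t)) => ?; case: (leP _ (2 * t - 1)) => ?;
  by split => [||?|?]; lra.
Qed.

Lemma zigzag_continuous : continuous (@zigzag R).
Proof.
move=> x; apply: continuousD; first exact: cst_continuous.
apply: glue_continuous => [k t|k t t0]; last by rewrite clamp_le0// mulr0.
by apply: (@continuousM _ _ (cst _) (@clamp R));
  [exact: cst_continuous | exact: clamp_continuous].
Qed.

Lemma zigzag_le0 x : x <= 0 -> zigzag x = 1.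
Proof.
move=> x0; rewrite /zigzag glue_le0 ?addr0// => k t t0.
by rewrite clamp_le0// mulr0.
Qed.

Lemma zigzag_block (n : nat) t : 0 <= t <= 1 ->
  zigzag (n%:R + t) = (-2) ^+ n * (1 - 3 * t).
Proof.
move=> /[dup] t01 /andP[? ?]; rewrite /zigzag (@glue_block _ _ (fun k => -3 * (-2) ^+ k) _ _ n).
- rewrite (_ : n%:R + t - n%:R = t) ?clamp_id//; last by ring.
  (* The sum telescopes: each term is [(-2) ^+ k.+1 - (-2) ^+ k]. *)
  suff -> : \sum_(k < n) -3 * (-2) ^+ k = (-2) ^+ n - 1 :> R by ring.
  elim: n => [|n IH]; first by rewrite big_ord0 expr0 subrr.
  by rewrite big_ord_recr/= IH exprS; ring.
- by move=> k s s0; rewrite clamp_le0// mulr0.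
- by move=> k s s1; rewrite clamp_ge1// mulr1.
- by rewrite -natr1; apply/andP; split; lra.
Qed.

Lemma zigzag_nat (n : nat) : zigzag n%:R = (-2) ^+ n :> R.
Proof. by rewrite -[n%:R]addr0 zigzag_block ?lexx ?ler01// mulr0 subr0 mulr1. Qed.

Lemma zigzag_bound (n : nat) x : x <= n%:R -> `|zigzag x| <= 2 ^+ n.
Proof.
elim: n => [|n IH] xn; first by rewrite zigzag_le0// normr1.
have [/IH h|nx] := leP x n%:R.
  by apply: (le_trans h); rewrite exprS ler_peMl// ?exprn_ge0//; lra.
rewrite -natr1 in xn.
rewrite -[x](subrKC n%:R) zigzag_block; last by apply/andP; split; lra.
rewrite normrM normrX normrN (@ger0_norm _ 2)// exprSr ler_wpM2l//.
by rewrite ler_norml; apply/andP; split; lra.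
Qed.

Lemma warp_continuous A : continuous (@warp R A).
Proof.
by apply: glue_continuous => [k|k t]; [exact: seg_continuous | exact: seg_le0].
Qed.

Lemma warp_le0 A x : x <= 0 -> warp A x = 0.
Proof. by move=> x0; rewrite /warp glue_le0// => k t; exact: seg_le0. Qed.

Lemma warp_block A (n : nat) t : 0 <= t <= 1 ->
  warp A (n%:R + t) = n%:R + seg (A n) t.
Proof.
move=> /[dup] t01 /andP[? ?]; rewrite /warp (@glue_block _ _ (fun=> 1) _ _ n).
- by rewrite sumr_const card_ord (_ : n%:R + t - n%:R = t)//; ring.
- by move=> k s; exact: seg_le0.
- by move=> k s; exact: seg_ge1.
- by rewrite -natr1; apply/andP; split; lra.
Qed.

Lemma warp_nat A (n : nat) : warp A n%:R = n%:R :> R.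
Proof. by rewrite -[n%:R in LHS]addr0 warp_block ?lexx//= seg_le0// addr0. Qed.

Lemma real_block x : 0 <= x ->
  exists (n : nat) t, [/\ 0 <= t, t < 1 & x = n%:R + t].
Proof.
move=> /truncn_itv; set n := Num.truncn x; rewrite -natr1 => /andP[? ?].
by exists n, (x - n%:R); split; lra.
Qed.

Lemma warp_le A (n : nat) x : x <= n%:R -> warp A x <= n%:R.
Proof.
move=> xn; have [x0|/ltW x0] := leP x 0; first by rewrite warp_le0.
have [m [t [t0 /ltW t1 xE]]] := real_block x0.
have [h0 h1 _ _] := @seg_bounds (A m) t (introT andP (conj t0 t1)).
move: xn; rewrite xE warp_block ?t0// => mn.
have [mn'|nm] := ltnP m n.
  have : m.+1%:R <= n%:R :> R by rewrite ler_nat.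
  by rewrite -natr1; lra.
have : n%:R <= m%:R :> R by rewrite ler_nat.
move=> nm'; have t00 : t = 0 by lra.
by rewrite t00 seg_le0//; lra.
Qed.

End ZigzagWarp.

(** * Arcs and translation by odd multiples of [pi] *)

(* The set [P] of the header: [sin y >= 0] leaves the closed arcs, and
[cos y != -1] removes their right endpoints. *)
Definition arcs (R : realType) : set R :=
  [set y | 0 <= sin y] `&` [set y | cos y != -1].

Section Arcs.
Context {R : realType}.
Implicit Types (x y : R) (u v : R -> R).

(** The translation negates sine and cosine. Only [sin y = 0] is delicate: there [cos y] is 1 or -1,
    and half-openness keeps exactly one of the two points. *)
Lemma arcs_addpi n y : odd n -> arcs (y + pi *+ n) <-> ~ arcs y.
Proof.
move=> on; rewrite /arcs /= (alternatingn (@sinDpi R)) (alternatingn (@cosDpi R)).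
rewrite -signr_odd on expr1 !mulN1r.
have cs := cos2Dsin2 y; split=> [[s0 c0] [s0' c0']|nA].
  have s00 : sin y = 0 by lra.
  move/eqP: cs; rewrite s00 expr0n addr0 sqrf_eq1 (negbTE c0') orbF.
  by move=> /eqP cy; rewrite cy eqxx in c0.
have [s0|s0] := ltP (sin y) 0.
  split; first lra.
  apply: contraPneq s0 => cy; have {}cy : cos y = 1 by lra.
  have s00 : sin y ^+ 2 = 0 by move: cs; rewrite cy; lra.
  by move/eqP: s00; rewrite sqrf_eq0 => /eqP ->; rewrite ltxx.
have cy : cos y = -1 by apply/eqP; apply: contra_notT nA.
have s00 : sin y ^+ 2 = 0 by move: cs; rewrite cy; lra.
move/eqP: s00; rewrite sqrf_eq0 => /eqP ->; rewrite cy.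
by split; first lra; apply/eqP; lra.
Qed.

Lemma IVT_unordered u x y c : continuous u -> u x <= c <= u y ->
  exists z, u z = c.
Proof.
move=> cu ucu; have [xy|/ltW yx] := leP x y.
  by have [z [_ _ <-]] := IVT_le cu xy ucu; exists z.
have cNu : continuous (- u) by move=> z; apply: continuousN; exact: cu.
have [|z [_ _ /oppr_inj <-]] := IVT_le (v := - c) cNu yx; last by exists z.
by rewrite /= !lerN2 andbC.
Qed.

(** To pass the barrier, [u - v] would have to equal [pi *+ n] somewhere, and there exactly one of
    [u], [v] would lie in [arcs]. *)
Lemma arcs_eq_le u v n : continuous u -> continuous v ->
  (forall x, arcs (u x) <-> arcs (v x)) -> odd n ->
  u 0 - v 0 <= pi *+ n -> forall x, u x - v x <= pi *+ n.
Proof.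
move=> cu cv uv on uv0 x; have [//|/ltW lt] := leP (u x - v x) (pi *+ n).
have cuv : continuous (u - v) by move=> z; apply: continuousB; [exact: cu | exact: cv].
have [|z zE] := @IVT_unordered (u - v) 0 x (pi *+ n) cuv.
  by rewrite uv0 lt.
have {}zE : u z = v z + pi *+ n by rewrite -zE /= subrKC.
by have := uv z; rewrite zE arcs_addpi//; tauto.
Qed.

Lemma arcs_eq_bounded u v : continuous u -> continuous v ->
  (forall x, arcs (u x) <-> arcs (v x)) ->
  exists C, forall x, `|u x - v x| <= C.
Proof.
(* [pi *+ m.*2.+1] is an odd multiple beyond [|u 0 - v 0|], a barrier for both [u - v] and
   [v - u]. *)
move=> cu cv uv; pose m := Num.truncn `|u 0 - v 0|.
have lem : `|u 0 - v 0| <= pi *+ m.*2.+1.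
  rewrite (le_trans (ltW (truncnS_gt _)))// -/m -[leRHS]mulr_natr.
  apply: (@le_trans _ _ m.*2.+1%:R); first by rewrite ler_nat ltnS -addnn leq_addr.
  by rewrite ler_peMl//; have := @pi_ge2 R; lra.
have om : odd m.*2.+1 by rewrite /= odd_double.
move: lem; rewrite ler_norml => /andP[l1 l2].
exists (pi *+ m.*2.+1) => x; rewrite ler_norml; apply/andP; split.
  rewrite lerNl opprB; apply: arcs_eq_le => //; first by move=> y; split=> /uv.
  by rewrite -opprB lerNl.
exact: arcs_eq_le.
Qed.

Lemma D2_arcs_preimage u : continuous u -> D2_Sigma01 (u @^-1` @arcs R).
Proof.
move=> cu; exists ((@cos R \o u) @^-1` [set y | y != -1]).
exists ((@sin R \o u) @^-1` [set y | 0 <= y]); split.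
- apply: open_comp; last exact: open_neq.
  by move=> x _; exact: (comp_continuous cu (@continuous_cos R)).
- apply: preimage_closed; last exact: closed_ge.
  by move=> x _; exact: (comp_continuous cu (@continuous_sin R)).
- by rewrite setIC.
Qed.

End Arcs.

(** * Comparing warped zigzags *)

Section Reductions.
Context {R : realType}.
Implicit Types (A B : pred nat) (f : R -> R).

Lemma zig13 : zig (1/3) = 2/3 :> R.
Proof.
rewrite zigE; last by apply/andP; split; lra.
by case: (leP (2 * _) (1 - _)) => ?; case: leP => ?; lra.
Qed.

Lemma zig23 : zig (2/3) = 1/3 :> R.
Proof.
rewrite zigE; last by apply/andP; split; lra.
by case: (leP (2 * _) (1 - _)) => ?; case: leP => ?; lra.
Qed.

Lemma norm_lt_half (C q a : R) : 2 * C < `|q| -> `|q * a| <= C -> `|a| < 1/2.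
Proof.
rewrite normrM => Cq qa; rewrite ltNge; apply/negP => a2.
have : `|q| * (1/2) <= `|q| * `|a| by rewrite ler_wpM2l.
by lra.
Qed.

Lemma close_zigzag_bits A B f (C : R) : continuous f ->
  (forall x, `|zigzag (warp B (f x)) - zigzag (warp A x)| <= C) ->
  exists N, forall k, (N <= k)%N -> A k -> B k.
Proof.
move=> cf close.
have C0 : 0 <= C := le_trans (normr_ge0 _) (close 0).
pose N0 := Num.truncn (2 * C).
have large k : (N0 <= k)%N -> 2 * C < 2 ^+ k.
  move=> Nk; apply: (lt_le_trans (truncnS_gt _)).
  by rewrite -natrX ler_nat (leq_ltn_trans Nk)// ltn_expl.
(* From [N0] on, the zigzag's peaks exceed [2 * C]; the second bound makes [f] start left of [k + 1]
   at [N0]. *)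
exists (maxn N0 (Num.truncn (f N0%:R))) => k; rewrite geq_max => /andP[N0k fN0k] Ak.
apply/negPn/negP => /negbTE nBk.
have Ck := large _ N0k.
have q2 : `|(-2) ^+ k| = 2 ^+ k :> R by rewrite normrX normrN ger0_norm.
have q21 : `|(-2) ^+ k.+1| = 2 * 2 ^+ k :> R.
  by rewrite exprS normrM q2 normrN ger0_norm.
have Cq : 2 * C < `|(-2) ^+ k| by rewrite q2.
have fk_lt : f k%:R < k.+1%:R.
  (* Otherwise [f] reaches [k + 1] at some [x <= k]: a value of size [2 ^+ k.+1] would be within [C]
     of one of size at most [2 ^+ k]. *)
  rewrite ltNge; apply/negP => kf.
  have [||x [_ xk fx]] := @IVT_le _ f N0%:R k%:R k.+1%:R cf.
  - by rewrite ler_nat.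
  - by rewrite kf andbT ltW// -truncn_le_nat.
  have := close x; rewrite fx warp_nat zigzag_nat => cl.
  have := @zigzag_bound R k _ (warp_le A xk).
  have := lerB_dist ((-2) ^+ k.+1) (zigzag (warp A x)).
  by rewrite q21; lra.
have fk1_gt : k%:R < f k.+1%:R.
  rewrite ltNge; apply/negP => fk.
  have := close k.+1%:R; rewrite warp_nat zigzag_nat distrC => cl.
  have := @zigzag_bound R k _ (warp_le B fk).
  have := lerB_dist ((-2) ^+ k.+1) (zigzag (warp B (f k.+1%:R))).
  by rewrite q21; lra.
have warpB t : 0 <= t <= 1 -> zigzag (warp B (k%:R + t)) =
    (-2) ^+ k * (1 - 3 * zig t) :> R.
  move=> t01; rewrite warp_block// nBk zigzag_block//.
  by have [-> -> _ _] := seg_bounds false t01.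
have warpA t : 0 <= t <= 1 -> zigzag (warp A (k%:R + t)) =
    (-2) ^+ k * (1 - 3 * t) :> R.
  by move=> t01; rewrite warp_block// Ak/= clamp_id// zigzag_block.
rewrite -natr1 in fk_lt.
have fk_lt13 : f k%:R <= k%:R + 1/3.
  rewrite leNgt; apply/negP => fk.
  have t01 : 0 <= f k%:R - k%:R <= 1 by apply/andP; split; lra.
  have := close k%:R; rewrite warp_nat zigzag_nat -[f k%:R](subrKC k%:R) warpB//.
  rewrite -[X in _ - X]mulr1 -mulrBr => /(norm_lt_half Cq).
  have [_ _ + _] := seg_bounds false t01; rewrite ltr_norml => z13 /andP[? ?].
  have : 1/3 <= zig (f k%:R - k%:R) by apply: z13; lra.
  by lra.
have fk1_gt23 : k%:R + 2/3 <= f k.+1%:R.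
  rewrite leNgt; apply/negP => fk.
  have t01 : 0 <= f k.+1%:R - k%:R <= 1 by apply/andP; split; lra.
  have := close k.+1%:R; rewrite warp_nat zigzag_nat -[f k.+1%:R](subrKC k%:R) warpB//.
  rewrite exprSr -mulrBr => /(norm_lt_half Cq).
  have [_ _ _] := seg_bounds false t01; rewrite ltr_norml => z23 /andP[? ?].
  have : zig (f k.+1%:R - k%:R) <= 2/3 by apply: z23; lra.
  by lra.
(* [f] crosses [k + 1/3] at [x1] and later [k + 2/3] at [x2]. The N swaps these heights, so
   closeness forces [x1 > k + 1/2 > x2], a contradiction. *)
have [||x1 [kx1 x1k fx1]] := @IVT_le _ f k%:R k.+1%:R (k%:R + 1/3) cf.
- by rewrite ler_nat.
- by apply/andP; split; lra.
have [|x2 [x12 x2k fx2]] := @IVT_le _ f x1 k.+1%:R (k%:R + 2/3) cf x1k.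
- by apply/andP; split; lra.
rewrite -natr1 in x1k x2k.
have := close x1; rewrite fx1 -{1}[x1](subrKC k%:R) warpB ?warpA; last 2 first.
- by apply/andP; split; lra.
- by apply/andP; split; lra.
rewrite zig13 -mulrBr => /(norm_lt_half Cq); rewrite ltr_norml => /andP[? ?].
have := close x2; rewrite fx2 -{1}[x2](subrKC k%:R) warpB ?warpA; last 2 first.
- by apply/andP; split; lra.
- by apply/andP; split; lra.
rewrite zig23 -mulrBr => /(norm_lt_half Cq); rewrite ltr_norml => /andP[? ?].
by lra.
Qed.

(** Where [B] is straight, the inner path takes the shape of [A]; elsewhere [A] is N-shaped like
    [B], and the inner path is the identity. *)
Lemma warp_comp A B (k : nat) (x : R) :
  (forall i, (k <= i)%N -> A i -> B i) -> k%:R <= x ->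
  warp B (warp (fun i => A i || ~~ B i) x) = warp A x.
Proof.
move=> AB kx; have [|n [t [t0 t1 xE]]] := @real_block R x.
  by rewrite (le_trans _ kx).
have t01 : 0 <= t <= 1 by rewrite t0 ltW.
have kn : (k <= n)%N.
  by rewrite -ltnS -(ltr_nat R) (le_lt_trans kx)// xE -natr1 ltrD2l.
have {}AB := AB n kn.
rewrite xE !warp_block//; last first.
  by have [-> ->] := @seg_bounds R (A n || ~~ B n) t t01.
case Bn : (B n) AB => AB /=.
  by rewrite orbF clamp_id//; have [-> ->] := @seg_bounds R (A n) t t01.
have -> : A n = false by apply/negP => /AB.
by rewrite /= clamp_id.
Qed.

(** Up to [k] the zigzag has size at most [2 ^+ k], and its run from [(-2) ^+ k] to [(-2) ^+ k.+1]
    covers all such values. *)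
Lemma zigzag_fold (k : nat) (x : R) : x <= k.+1%:R ->
  exists2 t, 0 <= t <= 1 & zigzag x = (-2) ^+ k * (1 - 3 * t).
Proof.
move=> xk; have [xk'|kx] := leP x k%:R; last first.
  exists (x - k%:R); first by apply/andP; rewrite -natr1 in xk; split; lra.
  rewrite -zigzag_block ?subrKC//.
  by apply/andP; rewrite -natr1 in xk; split; lra.
have q0 : (-2) ^+ k != 0 :> R by rewrite expf_neq0// oppr_eq0 pnatr_eq0.
exists ((1 - zigzag x / (-2) ^+ k) / 3); last by field.
have : `|zigzag x / (-2) ^+ k| <= 1.
  rewrite normrM normfV normrX normrN (@ger0_norm _ 2)//.
  by rewrite ler_pdivrMr ?exprn_gt0// mul1r zigzag_bound.
by rewrite ler_norml => /andP[? ?]; apply/andP; split; lra.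
Qed.

Lemma warp_reduction A B (k : nat) : A k -> B k ->
  (forall i, (k < i)%N -> A i -> B i) ->
  exists2 f : R -> R, continuous f &
    forall x, zigzag (warp B (f x)) = zigzag (warp A x).
Proof.
move=> Ak Bk AB.
have q0 : (-2) ^+ k != 0 :> R by rewrite expf_neq0// oppr_eq0 pnatr_eq0.
(* [zigzag], then the inverse of its affine run over [[k, k + 1]]. *)
pose fold (y : R) : R := k%:R + (1 - zigzag y / (-2) ^+ k) / 3.
have fold_cont : continuous fold.
  move=> y; rewrite /fold.
  apply: cvgD; first exact: cvg_cst.
  apply: cvgM; last exact: cvg_cst.
  apply: cvgB; first exact: cvg_cst.
  by apply: cvgM; [exact: zigzag_continuous | exact: cvg_cst].
have foldE y : y <= k.+1%:R -> zigzag (warp B (fold y)) = zigzag y.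
  move=> /zigzag_fold[t t01 yE].
  have -> : fold y = k%:R + t by rewrite /fold yE; field.
  by rewrite warp_block// Bk/= clamp_id// zigzag_block.
have fold_end : fold k.+1%:R = k.+1%:R.
  by rewrite /fold zigzag_nat exprS -natr1; field.
pose D := fun i => A i || ~~ B i.
(* [min] and [max] join two maps at [k + 1]: left of it the second summand is 0, right of it the
   first is constantly [k + 1]. *)
exists (fun x => fold (warp A (Num.min x k.+1%:R))
                 + (warp D (Num.max x k.+1%:R) - k.+1%:R)).
  have min_cont : continuous (fun x : R => Num.min x k.+1%:R).
    move=> x; apply: (@continuous_min _ _ id (cst _)); first exact: cvg_id.
    exact: cst_continuous.
  have max_cont : continuous (fun x : R => Num.max x k.+1%:R).
    move=> x; apply: (@continuous_max _ _ id (cst _)); first exact: cvg_id.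
    exact: cst_continuous.
  move=> x; apply: cvgD; last (apply: cvgB; last exact: cvg_cst).
    exact: (comp_continuous
      (comp_continuous min_cont (@warp_continuous R A)) fold_cont).
  exact: (comp_continuous max_cont (@warp_continuous R D)).
move=> x; have [xk|/ltW kx] := leP x k.+1%:R.
  by rewrite warp_nat subrr addr0 foldE// warp_le.
by rewrite warp_nat fold_end subrKC (warp_comp AB).
Qed.

End Reductions.

(** * Coding subsets by bits, and the reduction *)

(* Even positions are always straight, leaving infinitely many runs onto which an
initial segment can be folded. *)
Definition bits (a : set nat) : pred nat := fun k => ~~ odd k || `[< a k./2 >].

Lemma subset_fin_bits (a b : set nat) :
  subset_fin a b <-> exists N, forall k, (N <= k)%N -> bits a k -> bits b k.
Proof.
split=> [/finite_seqP[s sE]|[N abN]].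
  (* From this position on, [k./2] exceeds every element of [s]. *)
  exists (\max_(n <- s) n).+1.*2 => k Nk; rewrite /bits.
  case: (odd k) => //= /asboolP ak; apply/asboolP; apply: contrapT => nbk.
  have ks : k./2 \in s by have : (a `\` b) k./2 by []; rewrite sE.
  have := half_leq Nk; rewrite doubleK ltnNge => /negP; apply.
  exact: (@leq_bigmax_seq _ s xpredT id).
apply: (sub_finite_set _ (finite_II N)) => n [an nbn] /=.
rewrite ltnNge; apply/negP => Nn; apply: nbn.
have := abN n.*2.+1; rewrite /bits /= odd_double /= uphalf_double.
rewrite (asboolT an) => /(_ _ isT)/asboolP; apply.
by rewrite (leq_trans Nn)// -addnn leqW// leq_addr.
Qed.

Theorem theorem1p1 (R : realType) :
  exists F : set nat -> set R,
    (forall a : set nat, D2_Sigma01 (F a)) /\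
    (forall a b : set nat, subset_fin a b <-> wadge_le (F a) (F b)).
Proof.
have cont a : continuous (fun x : R => zigzag (warp (bits a) x)).
  exact: (comp_continuous (@warp_continuous R _) (@zigzag_continuous R)).
exists (fun a => (fun x : R => zigzag (warp (bits a) x)) @^-1` @arcs R).
split=> [a|a b]; first exact: D2_arcs_preimage.
rewrite subset_fin_bits; split=> [[N ab]|[f [cf FE]]].
  (* [N.*2] is an even position, at least [N], so both warps are straight there. *)
  have [|||f cf fE] := @warp_reduction R (bits a) (bits b) N.*2.
  - by rewrite /bits odd_double.
  - by rewrite /bits odd_double.
  - move=> i Ni; apply: ab; apply: leq_trans (ltnW Ni).
    by rewrite -addnn leq_addr.
  exists f; split=> //; apply/seteqP.
  by split=> x /=; rewrite fE.
have [||x|C close] := @arcs_eq_bounded R (fun x => zigzag (warp (bits b) (f x)))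
  (fun x => zigzag (warp (bits a) x)).
- exact: (comp_continuous cf (cont b)).
- exact: cont.
- by move/seteqP: FE => [ab ba]; split; [exact: ba | exact: ab].
exact: close_zigzag_bits cf close.
Qed.
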